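(* Let $\hat x\in X$ be a feasible interdiction strategy and let $\underline z\in\mathbb{R}$ be a lower bound on $z^*$, i.e. $\underline z\le z^*$. Then the inequality $$\theta\ge \Phi_I(\hat x)-\sum_{i\in N}\min\{(\Phi_I(\hat x)-\underline z)^+,\, d_i\}\,\hat x_i w_i$$ is valid for the fortification game and dominates the fortification cut $\theta\ge \Phi_I(\hat x)-\sum_{i\in N} d_i\hat x_i w_i$ for the interdiction strategy $\hat x$.
   Context: For $\alpha\in\mathbb{R}$, $(\alpha)^+=\max\{\alpha,0\}$. Let $N$ be a finite set of assets, $n=|N|$. For each $i\in N$ let $f_i\ge 0$ be a fortification cost, $g_i\ge 0$ an interdiction cost, and $d_i\ge 0$ a depreciation; let $B_F\ge 0$ and $B_I\ge 0$ be the fortification and interdiction budgets. Let $c\in\mathbb{R}^n$ and let $Y\subseteq\{0,1\}^n$ be nonempty (the feasible set of the recourse problem). Define - $W=\{w\in\{0,1\}^n:\sum_{i\in N} f_i w_i\le B_F\}$ (feasible fortification strategies), - $X=\{x\in\{0,1\}^n:\sum_{i\in N} g_i x_i\le B_I\}$ (interdiction strategies), - $X(w)=\{x\in X: x_i\le 1-w_i\ \forall i\in N\}$ for $w\in W$, - $\Phi_I(x)=\min_{y\in Y}\{c^Ty+\sum_{i\in N} d_i x_i y_i\}$ for $x\in X$, - $\Phi_F(w)=\max_{x\in X(w)}\Phi_I(x)$ for $w\in W$. The fortification game is $z^*=\min_{w\in W}\Phi_F(w)$, equivalently $\min\{\theta: w\in W,\ \theta\in\mathbb{R},\ \theta\ge\Phi_F(w)\}$.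 An inequality in $(w,\theta)$ is valid for the fortification game if it is satisfied by every $(w,\theta)$ with $w\in W$ and $\theta\ge\Phi_F(w)$. An inequality $\theta\ge a(w)$ dominates an inequality $\theta\ge b(w)$ if $a(w)\ge b(w)$ for all $w\in[0,1]^n$. *)

(* Defs.v *)
From mathcomp Require Import all_boot all_order all_algebra.
Set Implicit Arguments.
Unset Strict Implicit.
Unset Printing Implicit Defensive.
Import Order.TTheory GRing.Theory Num.Theory.
Local Open Scope ring_scope.

(* Minimum and maximum of a real-valued function over a finite set. The value
   0 on the empty set is junk: Y, W and every X(w) below are nonempty. *)
Definition min_over (R : realFieldType) (T : finType) (A : {set T})
    (F : T -> R) : R :=
  if [pick a in A] is Some a0 then F [arg min_(a < a0 in A) F a]%O else 0.

Definition max_over (R : realFieldType) (T : finType) (A : {set T})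
    (F : T -> R) : R :=
  if [pick a in A] is Some a0 then F [arg max_(a > a0 in A) F a]%O else 0.

Lemma min_overP (R : realFieldType) (T : finType) (A : {set T}) (F : T -> R) :
  A != set0 ->
  exists2 a, a \in A &
    min_over A F = F a /\ (forall b, b \in A -> F a <= F b).
Proof.
move=> /set0Pn[a1 Aa1]; rewrite /min_over.
case: pickP => [a0 Aa0|/(_ a1)]; last by rewrite Aa1.
by case: arg_minP => // a Aa minF; exists a.
Qed.

Lemma max_overP (R : realFieldType) (T : finType) (A : {set T}) (F : T -> R) :
  A != set0 ->
  exists2 a, a \in A &
    max_over A F = F a /\ (forall b, b \in A -> F b <= F a).
Proof.
move=> /set0Pn[a1 Aa1]; rewrite /max_over.
case: pickP => [a0 Aa0|/(_ a1)]; last by rewrite Aa1.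
by case: arg_maxP => // a Aa maxF; exists a.
Qed.

Definition pos_part (R : realFieldType) (a : R) : R := Num.max a 0.

Record fort_game (R : realFieldType) (N : finType) := FortGame {
  fort_cost : {ffun N -> R};
  int_cost : {ffun N -> R};
  depr : {ffun N -> R};
  fort_budget : R;
  int_budget : R;
  obj_cost : {ffun N -> R};
  recourse : {set {ffun N -> bool}};
  fort_cost_ge0 : forall i, 0 <= fort_cost i;
  int_cost_ge0 : forall i, 0 <= int_cost i;
  depr_ge0 : forall i, 0 <= depr i;
  fort_budget_ge0 : 0 <= fort_budget;
  int_budget_ge0 : 0 <= int_budget;
  recourse_neq0 : recourse != set0
}.

Section FortificationGame.
Variables (R : realFieldType) (N : finType) (G : fort_game R N).

(* Elements of {0,1}^N are boolean vectors; [real_vec] embeds them in R^N. *)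
Definition real_vec (w : {ffun N -> bool}) : {ffun N -> R} :=
  [ffun i => (w i)%:R].

Definition fort_set : {set {ffun N -> bool}} :=
  [set w : {ffun N -> bool} |
    \sum_i fort_cost G i * (w i)%:R <= fort_budget G].

Definition int_set : {set {ffun N -> bool}} :=
  [set x : {ffun N -> bool} |
    \sum_i int_cost G i * (x i)%:R <= int_budget G].

Definition int_set_at (w : {ffun N -> bool}) : {set {ffun N -> bool}} :=
  [set x in int_set | [forall i, (x i)%:R <= 1 - (w i)%:R :> R]].

Definition Phi_I (x : {ffun N -> bool}) : R :=
  min_over (recourse G) (fun y =>
    \sum_i obj_cost G i * (y i)%:R + \sum_i depr G i * (x i)%:R * (y i)%:R).

Definition Phi_F (w : {ffun N -> bool}) : R := max_over (int_set_at w) Phi_I.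

Definition z_star : R := min_over fort_set Phi_F.

Lemma fort_set_neq0 : fort_set != set0.
Proof.
apply/set0Pn; exists [ffun=> false]; rewrite inE big1 ?fort_budget_ge0 //.
by move=> i _; rewrite ffunE mulr0.
Qed.

Lemma int_set_at_neq0 (w : {ffun N -> bool}) : int_set_at w != set0.
Proof.
apply/set0Pn; exists [ffun=> false]; rewrite !inE; apply/andP; split.
  by rewrite big1 ?int_budget_ge0 // => i _; rewrite ffunE mulr0.
by apply/forallP => i; rewrite ffunE subr_ge0; case: (w i); rewrite ?ler01.
Qed.

(* An inequality in (w, theta) is a predicate on R^N x R. *)
Definition valid_ineq (P : {ffun N -> R} -> R -> Prop) : Prop :=
  forall (w : {ffun N -> bool}) (theta : R),
    w \in fort_set -> Phi_F w <= theta -> P (real_vec w) theta.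

Definition theta_ge (a : {ffun N -> R} -> R) : {ffun N -> R} -> R -> Prop :=
  fun w theta => a w <= theta.

Definition fort_cut (xhat : {ffun N -> bool}) (w : {ffun N -> R}) : R :=
  Phi_I xhat - \sum_i depr G i * (xhat i)%:R * w i.

Definition strengthened_cut (xhat : {ffun N -> bool}) (zlb : R)
    (w : {ffun N -> R}) : R :=
  Phi_I xhat -
    \sum_i Num.min (pos_part (Phi_I xhat - zlb)) (depr G i) * (xhat i)%:R * w i.

End FortificationGame.

(* Domination of the inequality theta >= b(w) by theta >= a(w). *)
Definition dominates (R : realFieldType) (N : finType)
    (a b : {ffun N -> R} -> R) : Prop :=
  forall w : {ffun N -> R}, (forall i, 0 <= w i <= 1) -> b w <= a w.

(* Main.v *)
Require Import Defs.
From mathcomp Require Import all_boot all_order all_algebra.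
Import Order.TTheory GRing.Theory Num.Theory.
Local Open Scope ring_scope.

(** Let [w] be a fortification. If some fortified asset [i] attacked by [xhat]
    has [d_i >= (Phi_I xhat - zlb)^+], the right-hand side of the strengthened
    cut at [w] is at most [zlb], hence at most [Phi_F w]. Otherwise the cut
    coincides at [w] with the fortification cut, which holds because
    [xhat] restricted to the unfortified assets is a feasible answer to [w] and
    each dropped attack lowers the recourse value by at most [d_i]. *)

Lemma min_over_le (R : realFieldType) (T : finType) (A : {set T}) (F : T -> R)
  (a : T) : a \in A -> min_over A F <= F a.
Proof.
move=> aA; have A0 : A != set0 by apply/set0Pn; exists a.
by have [b _ [-> minF]] := min_overP F A0; exact: minF.
Qed.

Lemma max_over_ge (R : realFieldType) (T : finType) (A : {set T}) (F : T -> R)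
  (a : T) : a \in A -> F a <= max_over A F.
Proof.
move=> aA; have A0 : A != set0 by apply/set0Pn; exists a.
by have [b _ [-> maxF]] := max_overP F A0; exact: maxF.
Qed.

Definition unfortified {N : finType} (x w : {ffun N -> bool}) :
  {ffun N -> bool} := [ffun i => x i && ~~ w i].

(** Dropping attacks keeps the interdiction budget satisfied because the costs are nonnegative. *)
Lemma unfortified_int_set_at (R : realFieldType) (N : finType)
  (G : fort_game R N) (x w : {ffun N -> bool}) :
  x \in int_set G -> unfortified x w \in int_set_at G w.
Proof.
rewrite !inE => xX; apply/andP; split.
  apply: le_trans xX; apply: ler_sum => i _; apply: ler_wpM2l.
    exact: int_cost_ge0.
  by rewrite ffunE ler_nat; case: (x i); case: (w i).
apply/forallP => i; rewrite ffunE.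
by case: (x i); case: (w i); rewrite ?subrr ?subr0 ?ler01.
Qed.

(** The set of recourse decisions does not depend on the attack, so an optimal [y] against the
    reduced attack can also be played against [x]. There it costs [d_i * y_i <= d_i] more for each
    dropped attack [i]. *)
Lemma Phi_I_unfortified_ge (R : realFieldType) (N : finType)
  (G : fort_game R N) (x w : {ffun N -> bool}) :
  fort_cut G x (real_vec R w) <= Phi_I G (unfortified x w).
Proof.
rewrite /fort_cut lerBlDr {2}/Phi_I.
have [y yY [-> _]] := min_overP (fun y : {ffun N -> bool} =>
  \sum_i obj_cost G i * (y i)%:R +
  \sum_i depr G i * (unfortified x w i)%:R * (y i)%:R) (recourse_neq0 G).
apply: le_trans (min_over_le _ _ _ _ _ yY) _.
(* The terms in [obj_cost] cancel, leaving [d_i x_i y_i <= d_i x_i (1 - w_i) y_i + d_i x_i w_i] for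
   each [i]. *)
rewrite -addrA lerD2l -big_split; apply: ler_sum => i _ /=.
rewrite !ffunE; have := depr_ge0 G i.
by case: (x i); case: (w i); case: (y i);
  rewrite /= ?mulr0 ?mul0r ?mulr1 ?addr0 ?add0r.
Qed.

Lemma fort_cut_valid (R : realFieldType) (N : finType) (G : fort_game R N)
  (x : {ffun N -> bool}) :
  x \in int_set G -> valid_ineq G (theta_ge (fort_cut G x)).
Proof.
move=> xX w theta _; apply: le_trans.
apply: le_trans (Phi_I_unfortified_ge _ _ _ _ _) _.
exact/max_over_ge/unfortified_int_set_at.
Qed.

Lemma strengthened_cut_dominates (R : realFieldType) (N : finType)
  (G : fort_game R N) (x : {ffun N -> bool}) (z : R) :
  dominates (strengthened_cut G x z) (fort_cut G x).
Proof.
move=> w w01; rewrite /fort_cut /strengthened_cut lerD2l lerN2.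
apply: ler_sum => i _; apply: ler_wpM2r; first by case/andP: (w01 i).
by apply: ler_wpM2r; rewrite ?ler0n // ge_min lexx orbT.
Qed.

(** The term of [i] alone subtracts [(Phi_I x - z)^+ >= Phi_I x - z], and the other subtracted terms
    are nonnegative. *)
Lemma strengthened_cut_le_bound (R : realFieldType) (N : finType)
  (G : fort_game R N) (x w : {ffun N -> bool}) (z : R) (i : N) :
  x i -> w i -> pos_part (Phi_I G x - z) <= depr G i ->
  strengthened_cut G x z (real_vec R w) <= z.
Proof.
move=> xi wi le_d; rewrite /strengthened_cut lerBlDl -lerBlDr.
rewrite (bigD1 i) //= ffunE xi wi !mulr1 (min_idPl le_d).
rewrite ler_wpDr //; last by rewrite /pos_part le_max lexx.
apply: sumr_ge0 => j _; rewrite ffunE !mulr_ge0 ?ler0n //.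
by rewrite le_min depr_ge0 /pos_part le_max lexx orbT.
Qed.

(** Terms with [x i] or [w i] false vanish in both cuts; in the remaining ones the minimum is
    [d_i]. *)
Lemma strengthened_cut_eq (R : realFieldType) (N : finType)
  (G : fort_game R N) (x w : {ffun N -> bool}) (z : R) :
  (forall i, x i -> w i -> depr G i <= pos_part (Phi_I G x - z)) ->
  strengthened_cut G x z (real_vec R w) = fort_cut G x (real_vec R w).
Proof.
move=> ge_d; congr (_ - _); apply: eq_bigr => i _; rewrite ffunE.
have := ge_d i; case: (x i); case: (w i); rewrite ?mulr0 ?mul0r //.
by move=> /(_ isT isT)/min_idPr->.
Qed.

Theorem theorem3 (R : realFieldType) (N : finType) (G : fort_game R N)
  (xhat : {ffun N -> bool}) (xhatX : xhat \in int_set G)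
  (zlb : R) (zlb_le : zlb <= z_star G) :
  valid_ineq G (theta_ge (strengthened_cut G xhat zlb)) /\
  dominates (strengthened_cut G xhat zlb) (fort_cut G xhat).
Proof.
split; last exact: strengthened_cut_dominates.
move=> w theta wW le_theta; rewrite /theta_ge.
case: (pickP (fun i => [&& xhat i, w i &
    pos_part (Phi_I G xhat - zlb) <= depr G i])) => [i /and3P[xi wi le_d]|none].
  apply: le_trans (strengthened_cut_le_bound _ _ _ _ _ _ _ xi wi le_d) _.
  (* The chain is [zlb <= z_star G <= Phi_F G w <= theta]. *)
  apply: le_trans zlb_le (le_trans _ le_theta); exact: min_over_le.
rewrite strengthened_cut_eq; first exact: fort_cut_valid le_theta.
by move=> i xi wi; have := none i; rewrite xi wi /= leNgt => /negbFE/ltW.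
Qed.
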